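(* Let $q>1$ be an integer, let $P=(p_0,\dots,p_{q-1})$ satisfy $p_j>0$ for all $j$ and $\sum_{j=0}^{q-1}p_j=1$, and let $R=(r_0,r_1,\dots,r_{q-1})$ be a fixed tuple of real numbers such that $r_j\in(-1,1)$ for $j=0,\dots,q-1$, $\sum_{j=0}^{q-1} r_j=1$, and $0=\gamma_0<\gamma_j=\sum_{l=0}^{j-1}r_l<1$ for all $j\neq 0$. Let $(n_k)_{k\ge1}$ be a fixed sequence of positive integers with $n_i\neq n_j$ for $i\neq j$ and such that for every $n\in\mathbb N$ there is $k_0$ with $n_{k_0}=n$. Then the system of functional equations $$ f\left(\sigma_{\bar n_{k-1}}\circ \sigma_{\bar n_{k-2}}\circ \cdots \circ \sigma_{\bar n_1}(s)\right)=\gamma_{i_{n_k}}+r_{i_{n_k}}f\left(\sigma_{\bar n_{k}}\circ \sigma_{\bar n_{k-1}}\circ \cdots \circ \sigma_{\bar n_1}(s)\right),\qquad k=1,2,3,\dots, $$ where $s=\Delta^P_{i_1i_2\ldots i_k\ldots}$ and where for $k=1$ the left-hand side is $f(\sigma_0(s))=f(s)$, has the unique solution $$ G(s)=\gamma_{i_{n_1}}+\sum_{k=2}^{\infty}\left(\gamma_{i_{n_k}}\prod_{t=1}^{k-1}r_{i_{n_t}}\right) $$ in the class of determined (i.e. defined everywhere) and bounded functions on $[0,1]$.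
   Context: For $i\in\{0,\dots,q-1\}$ put $\beta_0=0$ and $\beta_i=\sum_{l=0}^{i-1}p_l$ for $i\ne0$. For a sequence of digits $i_k\in\{0,1,\dots,q-1\}$ write $$\Delta^P_{i_1i_2\ldots i_k\ldots}:=\beta_{i_1}+\sum_{k=2}^\infty\Big(\beta_{i_k}\prod_{j=1}^{k-1}p_{i_j}\Big)\in[0,1].$$ Every $s\in[0,1]$ has such a representation ($P$-representation). It is unique except for the ($P$-rational) numbers with two representations $\Delta^P_{i_1\ldots i_{m-1}i_m000\ldots}=\Delta^P_{i_1\ldots i_{m-1}[i_m-1][q-1][q-1]\ldots}$, $i_m\neq0$. The generalized shift operator $\sigma_m$ ($m\ge1$) deletes the $m$-th digit: $\sigma_m(\Delta^P_{i_1i_2\ldots i_k\ldots})=\Delta^P_{i_1\ldots i_{m-1}i_{m+1}i_{m+2}\ldots}$; $\sigma_0$ is the identity. For $k\ge1$, $\bar n_k=n_k-\varrho_k$, where $\varrho_k$ is the number of terms of the finite sequence $n_1,\dots,n_k$ that are less than $n_k$. Thus $\sigma_{\bar n_k}\circ\cdots\circ\sigma_{\bar n_1}(s)$ is obtained from $s=\Delta^P_{i_1i_2\ldots}$ by deleting the digits $i_{n_1},\dots,i_{n_k}$. The symbols $i_{n_k}$ always refer to the digits of the original $s$.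
   Formalization: No single f solves the system in general (e.g. q=2, p_j=r_j=1/2, n=2,1,3,4,…); existence is proved with f replaced at stage k by f_k, a uniformly bounded family with f_0=G. Uniqueness is also proved for a single f. P-rational s take the representation ending in zeros. *)

(* Defs.v *)
(* MathComp / MathComp-Analysis *)
From mathcomp Require Import all_boot all_order all_algebra.
From mathcomp Require Import all_classical all_reals all_analysis.

Set Implicit Arguments.
Unset Strict Implicit.
Unset Printing Implicit Defensive.

Import Order.TTheory GRing.Theory Num.Theory.
Import numFieldNormedType.Exports.
Local Open Scope classical_set_scope.
Local Open Scope ring_scope.

(* beta_i for w = P, gamma_i for w = (r_0, ..., r_(q-1)). *)
Definition cumul (R : realType) (w : seq R) (i : nat) : R := \sum_(l < i) w`_l.

(* A digit sequence d stands for i_1 i_2 ..., with d k = i_(k+1); the k-th term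
   below is the (k+1)-st term of the series, its product being empty at k = 0. *)
Definition digit_term (R : realType) (w : seq R) (d : nat -> nat) (k : nat) : R :=
  cumul w (d k) * \prod_(t < k) w`_(d t).

Definition digit_sum (R : realType) (w : seq R) (d : nat -> nat) : R :=
  limn (series (digit_term w d)).

(* Delta^P_{i_1 i_2 ...} *)
Notation Delta P d := (digit_sum P d).

(* Of the two representations of a P-rational number the one ending in zeros is
   kept; an infinite tail of digits q-1 is allowed only in the (unique)
   representation of 1. This set of sequences is stable under digit deletion. *)
Definition normal_digits (q : nat) (d : nat -> nat) : Prop :=
  (forall k, (d k < q)%N) /\
  ((forall m, exists2 k, (m <= k)%N & d k <> q.-1) \/ (forall k, d k = q.-1)).

Definition digits (R : realType) (q : nat) (P : q.-tuple R) (s : R) : nat -> nat :=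
  xget (fun=> 0%N) [set d | normal_digits q d /\ Delta P d = s].

(* i_m for m >= 1. *)
Definition digit (R : realType) (q : nat) (P : q.-tuple R) (s : R) (m : nat) : nat :=
  digits P s m.-1.

Definition delete_digit (m : nat) (d : nat -> nat) : nat -> nat :=
  fun k => if (k.+1 < m)%N then d k else d k.+1.

(* The generalized shift operator sigma_m. *)
Definition sigma (R : realType) (q : nat) (P : q.-tuple R) (m : nat) (s : R) : R :=
  if m == 0%N then s else Delta P (delete_digit m (digits P s)).

(* A sequence (n_k)_{k >= 1} is a function n : nat -> nat with n 0 ignored. *)
Definition enumerates_positive (n : nat -> nat) : Prop :=
  [/\ forall k, (0 < k)%N -> (0 < n k)%N,
      forall i j, (0 < i)%N -> (0 < j)%N -> i <> j -> n i <> n j &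
      forall m, (0 < m)%N -> exists2 k, (0 < k)%N & n k = m].

Definition rho (n : nat -> nat) (k : nat) : nat :=
  (\sum_(1 <= j < k.+1) (n j < n k))%N.

Definition nbar (n : nat -> nat) (k : nat) : nat := (n k - rho n k)%N.

(* sigma_(nbar_k) o ... o sigma_(nbar_1); the identity for k = 0. *)
Fixpoint shifts (R : realType) (q : nat) (P : q.-tuple R) (n : nat -> nat)
    (k : nat) (s : R) : R :=
  if k is k'.+1 then sigma P (nbar n k) (shifts P n k' s) else s.

Definition G_term (R : realType) (q : nat) (P r : q.-tuple R) (n : nat -> nat)
    (s : R) : nat -> R :=
  digit_term r (fun k => digit P s (n k.+1)).

Definition G (R : realType) (q : nat) (P r : q.-tuple R) (n : nat -> nat)
    (s : R) : R :=
  limn (series (G_term P r n s)).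

(* The system of functional equations. In its k-th equation the digits keep the
   positions they have in the original s, so the value of the unknown at
   sigma_(nbar_k) o ... o sigma_(nbar_1) (s) depends on the number x so obtained
   and on which positions n_1, ..., n_k were deleted: f k x is that value, and
   f 0 is the function on [0,1] which is sought. An ordinary function f solving
   all the equations is the stage-independent case [fun=> f]. Existence fails
   in general if stage independence is imposed: for q = 2, p_j = r_j = 1/2 and
   n = 2, 1, 3, 4, ..., the equations k >= 3 give f(0) = 0 and f(1/4) = 1/4,
   while the equation k = 1 at s = 1/4 gives f(1/4) = 1/2 + f(0)/2. *)
Definition solves_system (R : realType) (q : nat) (P r : q.-tuple R)
    (n : nat -> nat) (f : nat -> R -> R) : Prop :=
  forall (s : R) (k : nat), 0 <= s <= 1 ->
    f k (shifts P n k s) =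
      cumul r (digit P s (n k.+1))
      + r`_(digit P s (n k.+1)) * f k.+1 (shifts P n k.+1 s).

Definition bounded01 (R : realType) (f : R -> R) : Prop :=
  exists M : R, forall x, 0 <= x <= 1 -> `|f x| <= M.

Definition unif_bounded01 (R : realType) (f : nat -> R -> R) : Prop :=
  exists M : R, forall k x, 0 <= x <= 1 -> `|f k x| <= M.

(* Main.v *)
(* Along the stages of the system the value f_k at the k-th shift of s satisfies
   y_k = gamma_(d_k) + r_(d_k) y_(k+1) with d_k = i_(n_(k+1)). Since
   max |r_j| < 1, the only bounded sequence satisfying this recurrence starts at
   the sum of the digit series, which gives uniqueness. For existence, f_k is
   read off the digits of the shifted number itself: positions never yet deleted
   keep their relative order, so each undeleted digit of s is found at its old
   position minus the number of deleted positions below it. This uses that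
   d |-> Delta^P_d is a bijection from the normal digit sequences onto [0,1],
   obtained by the greedy expansion and the same contraction argument. *)
Require Import Defs.
From mathcomp Require Import all_boot all_order all_algebra.
From mathcomp Require Import all_classical all_reals all_analysis.
From mathcomp Require Import zify ring lra.

Set Implicit Arguments.
Unset Strict Implicit.
Unset Printing Implicit Defensive.

Import Order.TTheory GRing.Theory Num.Theory.
Import numFieldNormedType.Exports.
Local Open Scope ring_scope.

(** * Digit series for weights of modulus at most [c < 1], a setting shared by [P] and [r] *)

Definition contracting {R : realType} (q : nat) (w : seq R) (c : R) : Prop :=
  [/\ 0 <= c < 1, forall j, (j < q)%N -> `|w`_j| <= c &
      forall j, (j < q)%N -> 0 <= cumul w j <= 1].

Lemma cumul0 {R : realType} (w : seq R) : cumul w 0 = 0.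
Proof. by rewrite /cumul big_ord0. Qed.

Lemma cumulS {R : realType} (w : seq R) j : cumul w j.+1 = cumul w j + w`_j.
Proof. by rewrite /cumul big_ord_recr. Qed.

Lemma exists_contracting {R : realType} (q : nat) (w : seq R) :
  (forall j, (j < q)%N -> `|w`_j| < 1) ->
  (forall j, (j < q)%N -> 0 <= cumul w j <= 1) ->
  exists c, contracting q w c.
Proof.
move=> w_lt1 cumul_itv; exists (\big[Num.max/0]_(j < q) `|w`_j|); split=> //.
- by rewrite bigmax_ge_id bigmax_lt // => i _; exact: w_lt1.
- by move=> j jq; exact: (le_bigmax 0 (fun i : 'I_q => `|w`_i|) (Ordinal jq)).
Qed.

Lemma series_digit_termS {R : realType} (w : seq R) (d : nat -> nat) N :
  series (digit_term w d) N.+1 =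
    cumul w (d 0%N) + w`_(d 0%N) * series (digit_term w (d \o succn)) N.
Proof.
rewrite /series /= big_nat_recl // /digit_term big_ord0 mulr1.
rewrite mulr_sumr; congr (_ + _); apply: eq_bigr => i _.
by rewrite big_ord_recl mulrCA.
Qed.

Section Contracting.
Context {R : realType} {q : nat} {w : seq R} {c : R}.
Hypothesis w_contr : contracting q w c.
Implicit Type d : nat -> nat.

Lemma cvg_series_digit_term d :
  (forall k, d k < q)%N -> cvgn (series (digit_term w d)).
Proof.
case: w_contr => /andP[c0 c1] wc cumul_itv dq; apply: normed_cvg.
apply: (@series_le_cvg _ _ (geometric 1 c)) => [k|k|k|].
- exact: normr_ge0.
- by rewrite /geometric /= mul1r exprn_ge0.
- rewrite /geometric /= mul1r /digit_term normrM.
  rewrite -[leRHS]mul1r ler_pM //.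
    by have /andP[? ?] := cumul_itv _ (dq k); rewrite ger0_norm.
  rewrite normr_prod -[leRHS]mul1r -[in leRHS](card_ord k) -prodr_const mul1r.
  by apply: ler_prod => i _; rewrite normr_ge0 wc.
- by apply: is_cvg_geometric_series; rewrite ger0_norm.
Qed.

Lemma digit_sumS d : (forall k, d k < q)%N ->
  digit_sum w d = cumul w (d 0%N) + w`_(d 0%N) * digit_sum w (d \o succn).
Proof.
move=> dq; apply: cvg_lim => //; rewrite -cvg_shiftS.
under eq_fun do rewrite series_digit_termS.
apply: cvgD; first exact: cvg_cst.
by apply: cvgMl_tmp; apply: cvg_series_digit_term => k; exact: dq.
Qed.

(** The bound is the fixed point of [x |-> 1 + c * x], so peeling off the first digit carries it
    through all partial sums by induction. *)
Lemma digit_sum_bounded d :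
  (forall k, d k < q)%N -> `|digit_sum w d| <= (1 - c)^-1.
Proof.
case: w_contr => /andP[c0 c1] wc cumul_itv dq.
have B0 : 0 < 1 - c by rewrite subr_gt0.
have BE : 1 + c * (1 - c)^-1 = (1 - c)^-1 by field; rewrite gt_eqF.
have S_le N : `|series (digit_term w d) N| <= (1 - c)^-1.
  elim: N d dq => [|N IH] d dq.
    by rewrite /series /= big_geq // normr0 invr_ge0 ltW.
  rewrite series_digit_termS -BE (le_trans (ler_normD _ _)) // lerD //.
    by have /andP[? ?] := cumul_itv _ (dq 0%N); rewrite ger0_norm.
  by rewrite normrM ler_pM // ?wc //; apply: IH => k; exact: dq.
have cvgS := cvg_series_digit_term dq.
rewrite ler_norml; apply/andP; split.
- by apply: limr_ge => //; apply: nearW => N; have:= S_le N; rewrite ler_norml => /andP[].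
- by apply: limr_le => //; apply: nearW => N; have:= S_le N; rewrite ler_norml => /andP[].
Qed.

(** Unrolling the recurrence [N] times leaves a partial sum plus [y N] times a product of [N]
    weights; that remainder is at most [M * c ^+ N]. *)
Lemma digit_sum_unique d (y : nat -> R) (M : R) :
  (forall k, d k < q)%N -> (forall k, `|y k| <= M) ->
  (forall k, y k = cumul w (d k) + w`_(d k) * y k.+1) ->
  y 0%N = digit_sum w d.
Proof.
case: w_contr => /andP[c0 c1] wc _ dq yM yE.
have approx N : `|y 0%N - series (digit_term w d) N| <= M * c ^+ N.
  elim: N d y dq yM yE => [|N IH] d y dq yM yE.
    by rewrite /series /= big_geq // subr0 expr0 mulr1.
  rewrite series_digit_termS yE.
  rewrite opprD addrACA subrr add0r -mulrBr normrM exprS mulrCA.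
  rewrite ler_pM ?wc //.
  by apply: (IH (d \o succn) (y \o succn)) => k /=.
apply/esym/cvg_lim => //.
have McN : (M * c ^+ N @[N --> \oo] --> 0)%classic.
  by apply: cvg_geometric; rewrite ger0_norm.
apply: (@squeeze_cvgr _ _ _ _ (fun N => y 0%N - M * c ^+ N)
  (fun N => y 0%N + M * c ^+ N)).
- apply: nearW => N; have := approx N; rewrite ler_norml => /andP[? ?].
  by apply/andP; split; lra.
- by rewrite -[X in (_ --> X)%classic]subr0; apply: cvgB => //; exact: cvg_cst.
- by rewrite -[X in (_ --> X)%classic]addr0; apply: cvgD => //; exact: cvg_cst.
Qed.

End Contracting.

(** * The P-representation as a bijection from normal digit sequences onto [0,1] *)

Definition probability_vector {R : realType} (q : nat) (P : seq R) : Prop :=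
  [/\ (1 < q)%N, forall j, (j < q)%N -> 0 < P`_j & cumul P q = 1].

Section Representation.
Context {R : realType} {q : nat} {P : q.-tuple R}.
Hypothesis P_prob : probability_vector q P.
Implicit Types (d : nat -> nat) (s : R).

Lemma cumul_lt i j : (i < j <= q)%N -> cumul P i < cumul P j.
Proof.
case: P_prob => _ P0 _.
elim: j => [|j IH]; first by rewrite ltn0.
rewrite ltnS => /andP[ij jq]; rewrite cumulS; move: ij.
rewrite leq_eqVlt => /orP[/eqP-> | ij]; first by rewrite ltrDl P0.
by rewrite (lt_trans (IH _)) ?ltrDl ?P0 // ij ltnW.
Qed.

Lemma cumul_le i j : (i <= j <= q)%N -> cumul P i <= cumul P j.
Proof.
rewrite leq_eqVlt => /andP[/orP[/eqP-> //|ij] jq].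
by rewrite ltW // cumul_lt // ij.
Qed.

(** Since [1 < q], every weight leaves room for another positive one in a total of 1, hence is below
    1. *)
Lemma probability_contracting : exists c, contracting q P c.
Proof.
have [q1 P0 P1] := P_prob.
apply: exists_contracting => j jq; last first.
  by rewrite -P1 -{1}(cumul0 P) !cumul_le ?leqnn ?(ltnW jq).
rewrite gtr0_norm ?P0 // -P1.
have := cumulS P j; case: j jq => [|j] jq.
  by rewrite cumul0 add0r => <-; apply: cumul_lt; rewrite q1 leqnn.
have : cumul P 0 < cumul P j.+1 by rewrite cumul_lt // (ltnW jq).
have : cumul P j.+2 <= cumul P q by rewrite cumul_le // jq leqnn.
rewrite cumul0; lra.
Qed.

Lemma Delta_rec d : (forall k, d k < q)%N ->
  Delta P d = cumul P (d 0%N) + P`_(d 0%N) * Delta P (d \o succn).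
Proof. by have [c cP] := probability_contracting; exact: (digit_sumS cP). Qed.

Lemma Delta_itv d : (forall k, d k < q)%N -> 0 <= Delta P d <= 1.
Proof.
have [c cP] := probability_contracting; have [q1 P0 P1] := P_prob => dq.
have S_itv N : 0 <= series (digit_term P d) N <= 1.
  elim: N d dq => [|N IH] d dq.
    by rewrite /series /= big_geq // lexx ler01.
  rewrite series_digit_termS.
  have /andP[S0 S1] := IH (d \o succn) (fun k => dq k.+1).
  have pd := P0 _ (dq 0%N).
  have : cumul P 0 <= cumul P (d 0%N) by rewrite cumul_le //= ltnW.
  have : cumul P (d 0%N).+1 <= cumul P q by rewrite cumul_le // leqnn dq.
  rewrite cumul0 P1 cumulS => ? ?.
  by apply/andP; split; nra.
have cvgS := cvg_series_digit_term cP dq.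
apply/andP; split.
- by apply: limr_ge => //; apply: nearW => N; have /andP[] := S_itv N.
- by apply: limr_le => //; apply: nearW => N; have /andP[] := S_itv N.
Qed.

Lemma Delta_max : Delta P (fun=> q.-1) = 1.
Proof.
have [c cP] := probability_contracting; have [q1 P0 P1] := P_prob.
(* The constant 1 satisfies the recurrence because [cumul P q.-1] plus the last weight is the total
   mass 1. *)
apply/esym/(@digit_sum_unique _ _ _ _ cP _ (fun=> 1) 1) => k.
- by rewrite prednK // ltnW.
- by rewrite normr1.
- by rewrite mulr1 -cumulS prednK // ltnW.
Qed.

Lemma Delta_lt1 d k : (forall k, d k < q)%N -> d k <> q.-1 -> Delta P d < 1.
Proof.
have [q1 P0 P1] := P_prob; elim: k d => [|k IH] d dq dk.
  have /andP[_ D1] := @Delta_itv (d \o succn) (fun k => dq k.+1).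
  rewrite (Delta_rec dq) -P1; apply: (@le_lt_trans _ _ (cumul P (d 0%N).+1)).
    by rewrite cumulS lerD2l ler_piMr // ltW // P0.
  by rewrite cumul_lt // leqnn andbT; move: (dq 0%N) dk; lia.
have D1 := IH (d \o succn) (fun k => dq k.+1) dk.
rewrite (Delta_rec dq) -P1; apply: (@lt_le_trans _ _ (cumul P (d 0%N).+1)).
  by rewrite cumulS ltrD2l gtr_pMr // P0.
by rewrite cumul_le // leqnn dq.
Qed.

(** A digit other than [q.-1] in the tail keeps the tail value below 1. The resulting half-open
    cells are disjoint for distinct first digits, so the value determines the first digit. *)
Lemma Delta_first_digit d k : (forall k, d k < q)%N -> d k.+1 <> q.-1 ->
  cumul P (d 0%N) <= Delta P d < cumul P (d 0%N).+1.
Proof.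
have [_ P0 _] := P_prob => dq dk; rewrite (Delta_rec dq) cumulS.
have tq j : (d j.+1 < q)%N by exact: dq.
have /andP[t0 _] := @Delta_itv (d \o succn) tq.
have t1 := @Delta_lt1 (d \o succn) k tq dk.
by rewrite lerDl ltrD2l gtr_pMr ?P0 // t1 mulr_ge0 // ltW // P0.
Qed.

Lemma Delta_eq_le_digit d d' k k' :
  (forall k, d k < q)%N -> d k.+1 <> q.-1 ->
  (forall k, d' k < q)%N -> d' k'.+1 <> q.-1 ->
  Delta P d = Delta P d' -> (d 0 <= d' 0)%N.
Proof.
move=> dq dk d'q d'k' E; rewrite leqNgt; apply/negP => d'd.
have /andP[dD _] := Delta_first_digit dq dk.
have /andP[_ d'D] := Delta_first_digit d'q d'k'.
have := @cumul_le (d' 0%N).+1 (d 0%N).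
rewrite d'd ltnW // => /(_ isT) /le_trans-/(_ _ dD).
by rewrite E leNgt d'D.
Qed.

Lemma Delta_inj d d' :
  normal_digits q d -> normal_digits q d' -> Delta P d = Delta P d' -> d = d'.
Proof.
have [_ P0 _] := P_prob => -[dq d_norm] [d'q d'_norm].
(* If one sequence is constantly [q.-1], its value is 1, which no sequence of the other kind
   attains. *)
case: d_norm => [d_inf | dE]; case: d'_norm => [d'_inf | d'E]; last 3 first.
- have [k _ /Delta_lt1-/(_ dq)] := d_inf 0%N => + E.
  by rewrite E (_ : d' = fun=> q.-1) ?Delta_max ?ltxx //; exact/funext.
- have [k _ /Delta_lt1-/(_ d'q)] := d'_inf 0%N => + E.
  by rewrite -E (_ : d = fun=> q.-1) ?Delta_max ?ltxx //; exact/funext.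
- by move=> _; apply/funext => k; rewrite dE d'E.
move=> E; apply/funext => k.
(* First digits agree by comparing cells; cancelling the common positive weight passes the equality
   to the tails, which inherit infinitely many digits other than [q.-1]. *)
elim: k d d' dq d_inf d'q d'_inf E => [|k IH] d d' dq d_inf d'q d'_inf E;
  have [[//|j] _ dj] := d_inf 1%N; have [[//|j'] _ d'j'] := d'_inf 1%N;
  have d0E : d 0%N = d' 0%N by apply/eqP; rewrite eqn_leq
    (Delta_eq_le_digit dq dj d'q d'j') //
    (Delta_eq_le_digit d'q d'j' dq dj).
  exact: d0E.
apply: (IH (d \o succn) (d' \o succn)).
- by move=> i; exact: dq.
- by move=> m; have [[//|i] mi di] := d_inf m.+1; exists i.
- by move=> i; exact: d'q.
- by move=> m; have [[//|i] mi di] := d'_inf m.+1; exists i.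
- move: E; rewrite (Delta_rec dq) (Delta_rec d'q) d0E => /addrI.
  by apply: mulfI; rewrite gt_eqF // P0.
Qed.

(** The digit [e] is found by descending from [q] to the first [cumul P e] not exceeding [s]; [t] is
    the relative position of [s] in that cell. *)
Lemma greedy_digit s : 0 <= s < 1 ->
  exists e t, [/\ (e < q)%N, 0 <= t < 1 & s = cumul P e + P`_e * t].
Proof.
have [q1 P0 P1] := P_prob => /andP[s0 s1].
suff H : forall m, (m <= q)%N -> s < cumul P m -> exists e t,
    [/\ (e < q)%N, 0 <= t < 1 & s = cumul P e + P`_e * t].
  by apply: (H q) => //; rewrite P1.
elim=> [|e IH] eq_ se; first by move: se; rewrite cumul0 ltNge s0.
have [/IH|es] := ltP s (cumul P e); first by apply; exact: ltnW.
have pe := P0 _ eq_.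
exists e, ((s - cumul P e) / P`_e); split=> //.
  by rewrite ltr_pdivrMr // mul1r ltrBlDl -cumulS se divr_ge0 ?subr_ge0 // ltW.
by field; rewrite gt_eqF.
Qed.

Lemma Delta_surj s : 0 <= s <= 1 -> exists2 d, normal_digits q d & Delta P d = s.
Proof.
have [c cP] := probability_contracting; have [q1 P0 P1] := P_prob.
have max_q : (q.-1 < q)%N by rewrite prednK // ltnW.
move=> /andP[s0]; rewrite le_eqVlt => /orP[/eqP-> | s1].
  by exists (fun=> q.-1); [split=> //; right | exact: Delta_max].
have : forall t, exists p : nat * R, 0 <= t < 1 ->
    [/\ (p.1 < q)%N, 0 <= p.2 < 1 & t = cumul P p.1 + P`_(p.1) * p.2].
  move=> t; have [/greedy_digit[e [u etu]]|] := boolP (0 <= t < 1).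
    by exists (e, u).
  (* A dummy value outside [0,1), which the orbit [y] never leaves. *)
  by exists (0%N, 0).
move=> /choice[F FP]; pose y k := iter k (fun t => (F t).2) s.
have y_itv k : 0 <= y k < 1.
  by elim: k => [|k IH]; [rewrite s0 s1 | have [] := FP _ IH].
pose d k := (F (y k)).1; have dq k : (d k < q)%N by have [] := FP _ (y_itv k).
have yE k : y k = Delta P (fun i => d (k + i)%N).
  rewrite -[k in LHS]addn0.
  apply: (@digit_sum_unique _ _ _ _ cP _ (fun i => y (k + i)%N) 1) => i //.
    by have /andP[? ?] := y_itv (k + i)%N; rewrite ger0_norm // ltW.
  by rewrite addnS; have [] := FP _ (y_itv (k + i)%N).
exists d; last by rewrite -[s]/(y 0%N) yE.
(* A tail constantly [q.-1] from [m] on would give [y m = 1], but the greedy remainders stay below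
   1. *)
split=> //; left=> m; apply: contrapT => d_max.
have := y_itv m; rewrite yE (_ : (fun i => _) = fun=> q.-1).
  by rewrite Delta_max ltxx andbF.
apply/funext => i; apply: contrapT => di; apply: d_max.
by exists (m + i)%N; rewrite ?leq_addr.
Qed.

Lemma digitsK d : normal_digits q d -> digits P (Delta P d) = d.
Proof.
move=> d_norm; apply: xget_unique => // e [e_norm eE].
by apply: Delta_inj.
Qed.

Lemma digits_normal s : 0 <= s <= 1 -> normal_digits q (digits P s).
Proof. by move=> /Delta_surj[d d_norm <-]; rewrite digitsK. Qed.

Lemma DeltaK s : 0 <= s <= 1 -> Delta P (digits P s) = s.
Proof. by move=> /Delta_surj[d d_norm <-]; rewrite digitsK. Qed.

Lemma digit_lt s m : 0 <= s <= 1 -> (digit P s m < q)%N.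
Proof. by move=> /digits_normal[dq _]; exact: dq. Qed.

End Representation.

(** * Deleting and inserting digits in normal sequences *)

Lemma normal_delete_digit q m d :
  normal_digits q d -> normal_digits q (delete_digit m d).
Proof.
move=> [dq d_norm]; split; first by move=> k; rewrite /delete_digit; case: ifP.
case: d_norm => [d_inf|d_max]; [left=> N|right=> k].
- have [[|k] // Nk dk] := d_inf (N + m).+1.
  exists k; first by lia.
  by rewrite /delete_digit ifF //; lia.
- by rewrite /delete_digit; case: ifP.
Qed.

Definition insert_digit (m v : nat) (d : nat -> nat) : nat -> nat :=
  fun k => if (k.+1 < m)%N then d k else if k.+1 == m then v else d k.-1.

Lemma insert_digitK m v d : (0 < m)%N -> delete_digit m (insert_digit m v d) = d.
Proof.
move=> m0; apply/funext => k; rewrite /delete_digit /insert_digit.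
case: (ltnP k.+1 m) => [//|km]; rewrite ifF; last by lia.
by rewrite ifF //; lia.
Qed.

(** Inserting a copy of [d 0] keeps a sequence constantly [q.-1] constant; otherwise one more digit
    leaves infinitely many that differ from [q.-1]. *)
Lemma normal_insert_digit q m d :
  normal_digits q d -> normal_digits q (insert_digit m (d 0%N) d).
Proof.
move=> [dq d_norm]; split.
  by move=> k; rewrite /insert_digit; case: ifP => // _; case: ifP.
case: d_norm => [d_inf|d_max]; [left=> N|right=> k].
- have [k Nk dk] := d_inf (N + m)%N.
  exists k.+1; first by lia.
  rewrite /insert_digit ifF; last by lia.
  by rewrite ifF //; lia.
- by rewrite /insert_digit; case: ifP => // _; case: ifP.
Qed.

(** Extends [rho] to an arbitrary threshold: [rho n k] is the case [m = n k]. *)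
Definition count_deleted_below (n : nat -> nat) (k m : nat) : nat :=
  (\sum_(1 <= j < k.+1) (n j < m))%N.

Fixpoint delete_first (n : nat -> nat) (k : nat) (d : nat -> nat) : nat -> nat :=
  if k is k'.+1 then delete_digit (nbar n k) (delete_first n k' d) else d.

Lemma normal_delete_first q n k d :
  normal_digits q d -> normal_digits q (delete_first n k d).
Proof.
by move=> dn; elim: k => [|k IH] //=; exact: normal_delete_digit.
Qed.

(** * Positions of the surviving digits *)

Section DeletionOrder.
Context {n : nat -> nat}.
Hypothesis n_enum : enumerates_positive n.
Local Notation cnt := (count_deleted_below n).

Lemma count_deletedS k m : cnt k.+1 m = (cnt k m + (n k.+1 < m))%N.
Proof. by rewrite /count_deleted_below big_nat_recr. Qed.

Lemma nbarE k : nbar n k.+1 = (n k.+1 - cnt k (n k.+1))%N.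
Proof.
by rewrite /nbar -[rho n k.+1]/(cnt k.+1 (n k.+1)) count_deletedS ltnn addn0.
Qed.

Lemma count_deleted_position k a :
  cnt k a.+1 = (cnt k a + \sum_(1 <= j < k.+1) (n j == a))%N.
Proof.
rewrite -big_split; apply: eq_bigr => j _.
by rewrite ltnS leq_eqVlt; case: ltngtP.
Qed.

Lemma count_deleted_fresh k a : (forall j, (0 < j <= k)%N -> n j <> a) ->
  cnt k a.+1 = cnt k a.
Proof.
move=> fresh; rewrite count_deleted_position big_nat_cond big1 ?addn0 // => j.
by rewrite andbT ltnS => /fresh/eqP/negPf->.
Qed.

Lemma count_deleted_le_succ k a : (cnt k a.+1 <= (cnt k a).+1)%N.
Proof.
have [_ n_inj _] := n_enum; rewrite -[leqRHS]addn1 count_deleted_position leq_add2l.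
elim: k => [|k IH]; first by rewrite big_geq.
rewrite big_nat_recr //=; have [nka|] := eqVneq; last by rewrite addn0.
rewrite big_nat_cond big1 // => j; rewrite andbT ltnS => /andP[j0 jk].
by apply/eqP; rewrite eqb0 -nka; apply/eqP/n_inj => //; lia.
Qed.

(** The shifted position [m - cnt k m] is nondecreasing in [m], since each position is deleted at
    most once, and strictly increases just after a surviving [a]. Written additively to avoid
    truncated subtraction. *)
Lemma deleted_position_lt k a b : (forall j, (0 < j <= k)%N -> n j <> a) ->
  (a < b)%N -> (cnt k b + a < cnt k a + b)%N.
Proof.
move=> fresh; elim: b => // b IH; rewrite ltnS leq_eqVlt => /orP[/eqP<-|ab].
  by rewrite count_deleted_fresh //; lia.
by have := IH ab; have := count_deleted_le_succ k b; lia.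
Qed.

Lemma count_deleted_lt k m : (0 < m)%N -> (cnt k m < m)%N.
Proof.
have [n_pos _ _] := n_enum => m0.
have cnt0 : cnt k 0 = 0%N by rewrite /count_deleted_below big1.
(* Position 0 is never deleted, so it serves as the surviving position to the left of [m]. *)
have := @deleted_position_lt k 0 m; rewrite cnt0 addn0; apply=> // j /andP[j0 _].
by have := n_pos j j0; lia.
Qed.

Lemma nbar_gt0 k : (0 < nbar n k.+1)%N.
Proof.
by have [n_pos _ _] := n_enum; rewrite nbarE subn_gt0 count_deleted_lt // n_pos.
Qed.

(** Each deletion left of [m] moves its digit one place left and raises the count by one; a deletion
    to its right changes neither. The [.-1] converts positions from 1 to indices from 0. *)
Lemma delete_firstE k m d :
  (0 < m)%N -> (forall j, (0 < j <= k)%N -> n j <> m) ->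
  delete_first n k d (m - cnt k m).-1 = d m.-1.
Proof.
have [n_pos n_inj _] := n_enum => m0; elim: k => [|k IH] fresh.
  by rewrite /count_deleted_below big_geq // subn0.
have fresh' j : (0 < j <= k)%N -> n j <> m by move=> jk; apply: fresh; lia.
have n_fresh j : (0 < j <= k)%N -> n j <> n k.+1.
  by move=> /andP[j0 jk]; apply: n_inj => //; lia.
rewrite -(IH fresh') /= nbarE count_deletedS /delete_digit.
have nk_m : n k.+1 <> m by apply: fresh; rewrite leqnn.
have m_pos := count_deleted_lt k m0.
have nk_pos := count_deleted_lt k (n_pos k.+1 isT).
have [nk_lt|m_lt|/nk_m//] := ltngtP (n k.+1) m.
- have pos_lt := deleted_position_lt n_fresh nk_lt.
  by rewrite ifF; [congr delete_first|]; lia.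
- have pos_lt := deleted_position_lt fresh' m_lt.
  by rewrite addn0 ifT //; lia.
Qed.

End DeletionOrder.

(** * Composed shifts on numbers *)

Section Shifts.
Context {R : realType} {q : nat} {P : q.-tuple R} {n : nat -> nat}.
Hypothesis P_prob : probability_vector q P.
Hypothesis n_enum : enumerates_positive n.
Implicit Type s : R.

Lemma sigma_surj m s : 0 <= s <= 1 -> exists2 t, 0 <= t <= 1 & sigma P m t = s.
Proof.
move=> s01; rewrite /sigma; case: eqP => [_|/eqP m0]; first by exists s.
have s_norm := normal_insert_digit m (digits_normal P_prob s01).
exists (Delta P (insert_digit m (digits P s 0) (digits P s))).
  by apply: (Delta_itv P_prob); case: s_norm.
by rewrite digitsK // insert_digitK ?lt0n // DeltaK.
Qed.

Lemma shifts_surj k s : 0 <= s <= 1 ->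
  exists2 t, 0 <= t <= 1 & shifts P n k t = s.
Proof.
elim: k s => [|k IH] s s01; first by exists s.
have [u u01 us] := sigma_surj (nbar n k.+1) s01.
by have [t t01 tu] := IH u u01; exists t => //=; rewrite tu.
Qed.

(** Each [sigma] re-reads the digits of a number; deletion preserves normality, so exactly the
    remaining sequence is read back. Positivity of [nbar] rules out the identity branch of
    [sigma]. *)
Lemma shiftsE k s : 0 <= s <= 1 ->
  shifts P n k s = Delta P (delete_first n k (digits P s)).
Proof.
move=> s01; elim: k => [|k IH] /=; first by rewrite DeltaK.
rewrite IH /sigma gtn_eqF ?nbar_gt0 // digitsK //.
exact/normal_delete_first/digits_normal.
Qed.

Lemma shifts_itv k s : 0 <= s <= 1 -> 0 <= shifts P n k s <= 1.
Proof.
move=> s01; rewrite shiftsE //; apply: (Delta_itv P_prob).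
by case: (normal_delete_first n k (digits_normal P_prob s01)).
Qed.

Lemma digit_shifts k m s : 0 <= s <= 1 -> (k < m)%N ->
  digit P (shifts P n k s) (n m - count_deleted_below n k (n m)) =
  digit P s (n m).
Proof.
have [n_pos n_inj _] := n_enum => s01 km.
rewrite /digit shiftsE // digitsK //; last first.
  exact/normal_delete_first/digits_normal.
apply: delete_firstE => //; first by apply: n_pos; lia.
by move=> j /andP[j0 jk]; apply: n_inj; lia.
Qed.

End Shifts.

(** * Uniqueness and existence for the system *)

Section System.
Context {R : realType} {q : nat} {P r : q.-tuple R} {n : nat -> nat} {c : R}.
Hypothesis P_prob : probability_vector q P.
Hypothesis r_contr : contracting q r c.
Hypothesis n_enum : enumerates_positive n.
Implicit Types (s : R) (f : nat -> R -> R).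

Lemma bounded_solution_unique f k s :
  unif_bounded01 f -> solves_system P r n f -> 0 <= s <= 1 ->
  f k (shifts P n k s) = digit_sum r (fun j => digit P s (n (k + j).+1)).
Proof.
move=> [M fM] f_sol s01; rewrite -[k in LHS]addn0.
apply: (digit_sum_unique r_contr (y := fun j => f (k + j)%N (shifts P n (k + j) s))
  (M := M)).
- by move=> j; exact: digit_lt.
- by move=> j; apply: fM; exact: shifts_itv.
- by move=> j; rewrite addnS; exact: f_sol.
Qed.

(* After the positions n_1, ..., n_k are deleted, the digit formerly at position
   m = n_(k+1+j) stands at position m minus the number of deleted positions
   below m. *)
Definition staged_G k s : R := digit_sum r (fun j =>
  let m := n (k + j).+1 in digit P s (m - count_deleted_below n k m)).

Lemma staged_G_shifts k s : 0 <= s <= 1 ->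
  staged_G k (shifts P n k s) = digit_sum r (fun j => digit P s (n (k + j).+1)).
Proof.
move=> s01; congr (digit_sum r); apply/funext => j /=.
by apply: digit_shifts => //; rewrite ltnS leq_addr.
Qed.

Lemma staged_G_bounded : unif_bounded01 staged_G.
Proof.
exists (1 - c)^-1 => k s s01; apply: (digit_sum_bounded r_contr) => j.
exact: digit_lt.
Qed.

(** On shifted numbers both sides are digit series in the original digits of [s]; splitting off the
    first term of the stage [k] series leaves the stage [k.+1] series. *)
Lemma staged_G_solves : solves_system P r n staged_G.
Proof.
move=> s k s01; rewrite !staged_G_shifts //.
rewrite (digit_sumS r_contr); last by move=> j; exact: digit_lt.
rewrite addn0; congr (_ + _ * digit_sum r _); apply/funext => j /=.
by rewrite addSnnS.
Qed.

Lemma staged_G0 s : 0 <= s <= 1 -> staged_G 0 s = G P r n s.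
Proof. exact: (@staged_G_shifts 0). Qed.

Lemma cvg_series_G_term s : 0 <= s <= 1 -> cvgn (series (G_term P r n s)).
Proof.
by move=> s01; apply: (cvg_series_digit_term r_contr) => k; exact: digit_lt.
Qed.

Lemma G_bounded : bounded01 (G P r n).
Proof.
have [M GM] := staged_G_bounded.
by exists M => s s01; rewrite -staged_G0 //; exact: GM.
Qed.

End System.

Theorem theorem1 (R : realType) (q : nat) (hq : (1 < q)%N) (P r : q.-tuple R)
  (P_gt0 : forall j, (j < q)%N -> 0 < P`_j)
  (P_sum : \sum_(j < q) P`_j = 1)
  (r_itv : forall j, (j < q)%N -> -1 < r`_j < 1)
  (r_sum : \sum_(j < q) r`_j = 1)
  (gamma_itv : forall j, (0 < j < q)%N -> 0 < cumul r j < 1)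
  (n : nat -> nat) (n_enum : enumerates_positive n) :
  [/\ (* G is defined everywhere on [0,1] and bounded *)
      (forall s : R, 0 <= s <= 1 -> cvgn (series (G_term P r n s)))
        /\ bounded01 (G P r n),
      (* a bounded function satisfying all the equations is equal to G *)
      forall f : R -> R, bounded01 f -> solves_system P r n (fun=> f) ->
        forall s : R, 0 <= s <= 1 -> f s = G P r n s &
      (* the system has exactly one bounded solution, and it is G *)
      exists f : nat -> R -> R,
        [/\ unif_bounded01 f, solves_system P r n f,
            forall s : R, 0 <= s <= 1 -> f 0%N s = G P r n s &
            forall g : nat -> R -> R, unif_bounded01 g -> solves_system P r n g ->
              forall (k : nat) (s : R), 0 <= s <= 1 -> g k s = f k s]].
Proof.
have P_prob : probability_vector q P by [].
have [c r_contr] : exists c, contracting q r c.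
  apply: exists_contracting => j jq; first by rewrite ltr_norml r_itv.
  (* [gamma_itv] covers positive indices; at index 0 the cumulative sum is 0. *)
  case: j jq => [|j] jq; first by rewrite cumul0 lexx ler01.
  by have /andP[? ?] := gamma_itv j.+1 jq; rewrite !ltW.
split.
- split; last exact: (G_bounded P_prob r_contr n_enum).
  by move=> s; exact: (cvg_series_G_term P_prob r_contr).
- move=> f [M fM] f_sol s s01.
  have f_bnd : unif_bounded01 (fun=> f) by exists M => _; exact: fM.
  exact: (bounded_solution_unique P_prob r_contr n_enum 0 f_bnd f_sol s01).
- exists (@staged_G R q P r n); split.
  + exact: (staged_G_bounded P_prob r_contr).
  + exact: (staged_G_solves P_prob r_contr n_enum).
  + by move=> s; exact: staged_G0.
  (* Every point of [0,1] is a [k]-th shift of some [t], so the values forced on shifted numbers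
     determine [g k] on all of [0,1]. *)
  + move=> g g_bnd g_sol k s /(shifts_surj (n := n) P_prob k)[t t01 <-].
    by rewrite (bounded_solution_unique P_prob r_contr) // staged_G_shifts.
Qed.
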